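(* Let $\alpha,\beta$ be integers with $\alpha\equiv 7\pmod 9$ and $\beta\equiv 4\pmod 9$. Then $|G_3|=3^{5}$, the nilpotency class of $G_3$ is $3$, $o(a)=o(b)=9$ and $o(c)=3$.
   Context: $G(\alpha,\beta)=\langle A,B\mid A^{[A,B]}=A^{\alpha},\ B^{[B,A]}=B^{\beta}\rangle$ with $[x,y]=x^{-1}y^{-1}xy$, $y^x=x^{-1}yx$, and $C=[A,B]$. The group $G(\alpha,\beta)$ is finite and nilpotent, hence the direct product of its Sylow subgroups; $G_3$ denotes its Sylow $3$-subgroup and $a,b,c$ denote the images of $A,B,C$ under the canonical projection $G(\alpha,\beta)\to G_3$. $o(x)$ is the order of $x$. *)

(* Defs.v *)
From mathcomp Require Import all_boot all_algebra all_fingroup all_solvable.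
Set Implicit Arguments. Unset Strict Implicit. Unset Printing Implicit Defensive.

(* For an integer z, z = zpos z - zneg z with zpos z, zneg z natural numbers
   (one of them 0); used to write the integer power g^z of a group element
   as  g ^+ zpos z * g ^- zneg z  (the presentation syntax only has ^+ / ^-). *)
Definition zpos (z : int) : nat := if z is Posz n then n else 0%N.
Definition zneg (z : int) : nat := if z is Negz n then n.+1 else 0%N.

(* Main.v *)
Require Import Defs.
From mathcomp Require Import all_boot all_algebra all_fingroup all_solvable.
From mathcomp Require Import zify ring.

(* Let c = [~ x, y].  The relations show that c normalises <x> and <y>, that
   (x^i)^y = c^i x^(a S(a,i)) with S(a,i) = 1 + a + ... + a^(i-1), and
   symmetrically for y; so any finite group satisfying them is <x><c><y>.
   Since a = b = 1 mod 3, a power N of 3 dividing i also divides S(a,i), and the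
   same formulas make K = <x^N><c^N><y^N> a normal subgroup; for N = |G|_3 it
   is a 3-complement, and the Sylow 3-subgroup becomes Q = G / K.
   In Q, comparing [x, y^b]^c with [x^a, y] gives y^v = c^(a-b) z with
   z in <x^27> and 9 | v.  Conjugating this by y and by x shows that the
   generators of D = <x^9, c^3, y^9> lie in the Frattini subgroup of D,
   so D = 1 and |Q| <= 9 * 3 * 9.  Conversely a group of order 3^5 and class 3
   satisfying the relations exists inside 'S_9 x 'S_9. *)

Set Implicit Arguments.
Unset Strict Implicit.
Unset Printing Implicit Defensive.

(** * Geometric sums and their residues *)

Local Open Scope nat_scope.

Definition geosum (a i : nat) : nat := \sum_(j < i) a ^ j.

Lemma geosum0 a : geosum a 0 = 0%N.
Proof. by rewrite /geosum big_ord0. Qed.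

Lemma geosumS a i : geosum a i.+1 = (a * geosum a i).+1.
Proof.
rewrite /geosum big_ord_recl expn0 add1n big_distrr /=; congr _.+1.
by apply: eq_bigr => j _; rewrite -expnS.
Qed.

Lemma geosumD a i j : geosum a (i + j) = (geosum a i + a ^ i * geosum a j)%N.
Proof.
elim: i => [|i IHi]; first by rewrite geosum0 mul1n.
by rewrite addSn !geosumS IHi expnS mulnDr mulnA.
Qed.

Lemma geosumM a i j : geosum a (i * j) = (geosum a i * geosum (a ^ i) j)%N.
Proof.
elim: j => [|j IHj]; first by rewrite muln0 !geosum0 muln0.
by rewrite mulnS geosumD IHj geosumS mulnS mulnCA.
Qed.

Lemma expn_geosum d i : (d.+1 ^ i = (d * geosum d.+1 i).+1)%N.
Proof.
elim: i => [|i IHi]; first by rewrite geosum0 muln0.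
by rewrite expnS IHi geosumS !mulnS mulSn mulnCA !mulSn; lia.
Qed.

(** One copy of the sum is split off from [1 + (a - 1) * geosum a i]; what remains gives the
    exponents [u] and [v] that survive when two commutators are compared. *)
Lemma expn_geosum2 a i :
  1 < a -> a ^ i = geosum a i + (1 + (a - 2) * geosum a i).
Proof. by case: a => [|[|a]] // _; rewrite expn_geosum !subSS subn0; lia. Qed.

Lemma eq_geosum_mod a b i m :
  a = b %[mod m] -> geosum a i = geosum b i %[mod m].
Proof.
move=> eq_ab; elim: i => [|i IHi]; first by rewrite !geosum0.
rewrite !geosumS -(addn1 (a * _)) -(addn1 (b * _)).
by rewrite -modnDml -modnMm eq_ab IHi modnMm modnDml.
Qed.

Lemma geosum1 i : geosum 1 i = i.
Proof. by elim: i => [|i IHi]; rewrite ?geosum0 // geosumS IHi mul1n. Qed.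

(** For [i = p * j] the sum factors as [geosum a p * geosum (a ^ p) j]; the first factor is [p]
    modulo [p], and [a ^ p] is again 1 modulo [p]. *)
Lemma dvdn_geosum p k a i :
  a = 1 %[mod p] -> p ^ k %| i -> p ^ k %| geosum a i.
Proof.
elim: k a i => [|k IHk] a i a1; first by rewrite !dvd1n.
rewrite expnS => /dvdnP[j ->]; rewrite mulnCA geosumM.
apply: dvdn_mul; first by rewrite /dvdn (eq_geosum_mod _ a1) geosum1 modnn.
by apply: IHk; [rewrite -modnXm a1 modnXm exp1n | rewrite dvdn_mull].
Qed.

(* Reducing modulo [m] at each step keeps the numbers small enough to compute. *)
Lemma geosum_iter a i m :
  geosum a i = iter i (fun s => (a * s).+1 %% m) 0 %[mod m].
Proof.
elim: i => [|i IHi]; first by rewrite geosum0.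
rewrite geosumS iterS modn_mod -(addn1 (a * geosum _ _)) -(addn1 (a * iter _ _ _)).
by rewrite -modnDml -modnMmr IHi modnMmr modnDml.
Qed.

Lemma geosum_mod_index k a r :
  a = 1 %[mod 3] -> a = r %[mod 3 ^ k] ->
  forall i j, i = j %[mod 3 ^ k] -> geosum a i = geosum r j %[mod 3 ^ k].
Proof.
move=> a1 ar i j ij; rewrite -(eq_geosum_mod _ ar).
have red n : geosum a n = geosum a (n %% 3 ^ k) %[mod 3 ^ k].
  rewrite [in LHS](divn_eq n (3 ^ k)) geosumD.
  have d1 : 3 ^ k %| geosum a (n %/ 3 ^ k * 3 ^ k).
    by apply: dvdn_geosum => //; rewrite dvdn_mull.
  rewrite -modnDml (eqP d1) add0n -modnMml.
  have -> : a ^ (n %/ 3 ^ k * 3 ^ k) = 1 %[mod 3 ^ k].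
    case: a {ar} a1 d1 => [|d] // a1 d1.
    by rewrite expn_geosum -(addn1 (d * _)) -modnDml -modnMmr (eqP d1) muln0 mod0n.
  by rewrite modnMml mul1n.
by rewrite (red i) (red j) ij.
Qed.

(** * Consequences of the relations: conjugation formulas and normal subgroups *)

Local Open Scope group_scope.

Definition comm_pow (gT : finGroupType) (a : nat) (x y : gT) :=
  x ^ [~ x, y] = x ^+ a.

Lemma comm_powX (gT : finGroupType) a (x y : gT) i j :
  comm_pow a x y -> (x ^+ i) ^ ([~ x, y] ^+ j) = x ^+ (i * a ^ j).
Proof.
move=> xa; rewrite conjXg; elim: j => [|j IHj] in i *.
  by rewrite conjg1 muln1.
by rewrite expgS conjgM xa conjXg -expgM mulnC IHj expnS mulnA [(i * a)%N]mulnC.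
Qed.

(** With [c = [~ x, y]], the left side is [(x * c) ^+ i]; moving a [c] to the left replaces the
    passed power of [x] by its [a]-th power. *)
Lemma conjX_comm_pow (gT : finGroupType) a (x y : gT) i :
  comm_pow a x y -> (x ^+ i) ^ y = [~ x, y] ^+ i * x ^+ (a * geosum a i).
Proof.
move=> xa; rewrite conjXg conjg_mulR; elim: i => [|i IHi].
  by rewrite geosum0 muln0 mulg1.
rewrite expgSr IHi geosumS -mulgA (mulgA (x ^+ _) x) -expgSr.
rewrite (conjgC (x ^+ _)) mulgA -expgSr.
by rewrite conjXg xa -expgM.
Qed.

Lemma commX_conj (gT : finGroupType) a (x y : gT) i :
  comm_pow a x y -> ([~ x, y] ^+ i) ^ x = [~ x, y] ^+ i * x ^- (a ^ i) * x.
Proof.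
move=> xa; rewrite conjgE mulgA (conjgC x^-1) conjVg.
by rewrite -{2}(expg1 x) (comm_powX _ _ xa) mul1n.
Qed.

Lemma comm_normal (gT : finGroupType) a (x y : gT) N :
  comm_pow a x y -> [~ x, y] \in 'N(<[x ^+ N]>).
Proof.
by move=> xa; rewrite inE -cycleJ cycle_subG conjXg xa -expgM mulnC expgM mem_cycle.
Qed.

(** The product set is first shown to be normalised by [x]; this is what makes it closed under
    multiplication. The case [k = 0] factorises the whole group. *)
Lemma triple_product (gT : finGroupType) p k a b (x y : gT) :
    0 < a -> 0 < b -> comm_pow a x y -> comm_pow b y x ->
    a = 1 %[mod p] -> b = 1 %[mod p] ->
  let N := (p ^ k)%N in
  {K : {group gT} | K = <[x ^+ N]> * <[[~ x, y] ^+ N]> * <[y ^+ N]> :> {set gT}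
     & (x \in 'N(K)) && (y \in 'N(K))}.
Proof.
case: a => // a; case: b => // b _ _ xa yb a1 b1 N; set c := [~ x, y].
have dE : [~ y, x] = c^-1 by rewrite invg_comm.
have aN i : N %| i -> N %| geosum a.+1 i by apply: dvdn_geosum.
have bN i : N %| i -> N %| geosum b.+1 i by apply: dvdn_geosum.
have cXN i (g : gT) : N %| i -> g ^+ i \in <[g ^+ N]>.
  by move=> /dvdnP[j ->]; rewrite mulnC expgM mem_cycle.
have nXc : c \in 'N(<[x ^+ N]>) by apply: comm_normal xa.
have nYc : c \in 'N(<[y ^+ N]>) by rewrite -groupV -dE; apply: comm_normal yb.
set X := <[x ^+ N]>; set Z := <[c ^+ N]>; set Y := <[y ^+ N]>.
have nXZ : Z \subset 'N(X) by rewrite cycle_subG groupX.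
have nYZ : Z \subset 'N(Y) by rewrite cycle_subG groupX.
have dW := norm_joinEr nXZ.
have conjXX (g : gT) n : (g ^+ n) ^ g = g ^+ n by rewrite conjXg conjgE mulKg.
have XW := joing_subl X Z; have ZW := joing_subr X Z.
have nWx : x \in 'N(X <*> Z).
  rewrite inE conjYg -!cycleJ join_subG !cycle_subG.
  rewrite conjXX (subsetP XW) ?cycle_id //=.
  (* Here [a.+1 ^ N - 1] is a multiple of [geosum a.+1 N], hence of [N]. *)
  have -> : (c ^+ N) ^ x = c ^+ N * x ^- (a.+1 ^ N) * x by apply: commX_conj.
  rewrite -mulgA groupM ?(subsetP ZW _ (cycle_id _)) //.
  rewrite expn_geosum expgS invMg mulgKV groupV (subsetP XW) //.
  by apply: cXN; rewrite dvdn_mull ?aN.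
have YxZY g : g \in Y -> g ^ x \in Z * Y.
  case/cycleP=> i ->; rewrite -expgM (conjX_comm_pow _ yb) dE expVgn.
  have Ni : N %| N * i by rewrite dvdn_mulr.
  by apply: mem_mulg; [rewrite groupV |]; apply: cXN => //; rewrite dvdn_mull ?bN.
pose S := X <*> Z * Y.
have ZS : Z * Y \subset S by rewrite mulSg ?joing_subr.
have WS : X <*> Z * S = S by rewrite /S mulgA mulGid.
have SY : S * Y = S by rewrite /S -mulgA mulGid.
have nSx : x \in 'N(S).
  rewrite inE; apply/subsetP=> _ /imsetP[_ /mulsgP[w g Ww Yg ->] ->].
  rewrite conjMg -WS; apply: mem_mulg; first by rewrite memJ_norm.
  by rewrite (subsetP ZS) ?YxZY.
(* As [x] normalises the set [S], [S * X = X * S], and [S] absorbs [X] on the left. *)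
have SX : S * X \subset S.
  have nSX : X \subset 'N(S) by rewrite cycle_subG groupX.
  by rewrite -(normC nSX) -{2}WS mulSg ?joing_subl.
have SZ : S * Z \subset S.
  by rewrite /S -mulgA -(normC nYZ) mulgA mulSg // mulGSid ?joing_subr.
have gS : group_set S.
  apply/group_setP; split; first by rewrite -(mulg1 1) mem_mulg.
  move=> s t Ss; rewrite {1}/S dW => /mulsgP[_ g /mulsgP[u v Xu Zv ->] Yg ->].
  rewrite -SY !mulgA mem_mulg // (subsetP SZ) // mem_mulg // (subsetP SX) //.
  by rewrite mem_mulg.
pose K := Group gS; have dK : K = S :> {set gT} by [].
have sWK : X <*> Z \subset K by rewrite dK mulG_subl.
have sYK : Y \subset K by rewrite dK mulG_subr.
have sXK := subset_trans XW sWK; have sZK := subset_trans ZW sWK.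
have NM i : N %| N * i by rewrite dvdn_mulr.
exists K; first by rewrite dK /S dW.
apply/andP; split=> //; rewrite inE; apply/subsetP=> _ /imsetP[s Ks ->].
move: Ks; rewrite dK /S dW => /mulsgP[_ g /mulsgP[u v Xu Zv ->] Yg ->].
suff: (u * v * g) ^ y \in K by rewrite dK /S dW.
rewrite 2!conjMg; apply: groupM; first apply: groupM.
- case/cycleP: Xu => i ->; rewrite -expgM (conjX_comm_pow _ xa).
  apply: groupM; first by apply: (subsetP sZK); apply: cXN.
  by apply: (subsetP sXK); apply: cXN; rewrite dvdn_mull ?aN.
(* The relation of [y] gives the conjugates by [y] of powers of [c^-1], hence the passage to
   inverses. *)
- case/cycleP: Zv => i ->; rewrite -expgM -groupV -conjVg -expVgn -dE.
  rewrite (commX_conj _ yb) -mulgA dE expVgn; apply: groupM.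
    by rewrite groupV; apply: (subsetP sZK); apply: cXN.
  rewrite expn_geosum expgS invMg mulgKV groupV.
  by apply: (subsetP sYK); apply: cXN; rewrite dvdn_mull ?bN.
apply: (subsetP sYK); case/cycleP: Yg => i ->.
by rewrite conjXg conjXX mem_cycle.
Qed.

Lemma groupX_gcd (gT : finGroupType) (H : {group gT}) g i j :
  g ^+ i \in H -> g ^+ j \in H -> g ^+ gcdn i j \in H.
Proof.
case: (posnP i) => [-> | i_gt0] Hi Hj; first by rewrite gcd0n.
have [k _ /dvdnP[q def_q]] := Bezoutl j i_gt0.
rewrite -(groupMr _ (groupX k Hj)) -expgM -expgD [(j * k)%N]mulnC def_q mulnC expgM.
exact: groupX.
Qed.

(** * Exponents of the generators in a 3-group *)

Local Open Scope nat_scope.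

(** Each of [a - 1], [b - 1], [geosum a l] and [geosum b l] is divisible by 3 exactly once, so both
    products have 3-part 9. *)
Lemma geosum_gcdn27 a b l :
    a = 7 %[mod 9] -> b = 4 %[mod 9] -> l = 3 %[mod 9] ->
  [/\ 27 %| a * (1 + (a - 2) * geosum a a), 9 %| 1 + (b - 2) * geosum b b,
      gcdn ((a - 1) * geosum a l) 27 = 9 & gcdn ((b - 1) * geosum b l) 27 = 9].
Proof.
move=> a7 b4 l3.
have a1 : a = 1 %[mod 3] by lia.
have b1 : b = 1 %[mod 3] by lia.
have Sb : geosum b b = 4 %[mod 9].
  by rewrite (geosum_mod_index (k := 2) b1 b4 b4) geosum_iter.
have Sbl : geosum b l = 3 %[mod 9].
  by rewrite (geosum_mod_index (k := 2) b1 b4 l3) geosum_iter.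
have Sal : geosum a l = 3 %[mod 9].
  by rewrite (geosum_mod_index (k := 2) a1 a7 l3) geosum_iter.
have gcd9 n q r : ~~ (3 %| r) -> n = 9 * (3 * q + r) -> gcdn n 27 = 9.
  move=> r3 ->; rewrite -[27]/(9 * 3) -muln_gcdr; apply/eqP.
  rewrite -[X in _ == X]muln1 eqn_pmul2l // gcdnC.
  by rewrite -/(coprime _ _) prime_coprime // dvdn_addr ?dvdn_mulr.
have red k s r : s = r %[mod k] -> {q | s = q * k + r %% k}.
  by move=> <-; exists (s %/ k); apply: divn_eq.
split.
- have mod27 r s : a = r %[mod 27] -> geosum r r = s %[mod 27] -> 2 <= r < 27 ->
      s < 27 -> 27 %| 1 + (r - 2) * s -> 27 %| a * (1 + (a - 2) * geosum a a).
    move=> ar rs /andP[r2 r27] s27 Dr; apply: dvdn_mull.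
    have Sar : geosum a a = s %[mod 27].
      by rewrite (geosum_mod_index (k := 3) a1 ar ar).
    have [t ->] := red _ _ _ Sar; have [q ->] := red _ _ _ ar.
    rewrite !modn_small //.
    have -> : 1 + (q * 27 + r - 2) * (t * 27 + s)
      = 27 * (q * (t * 27 + s) + (r - 2) * t) + (1 + (r - 2) * s).
      by rewrite -addnBA //; ring.
    by rewrite dvdn_addr // dvdn_mulr.
  (* The residue modulo 9 has three lifts modulo 27, where [geosum a a] is 16, 25 and 7
     respectively. *)
  have: a = 7 %[mod 27] \/ a = 16 %[mod 27] \/ a = 25 %[mod 27] by lia.
  by case=> [|[]] ar; [apply: (mod27 7 16) | apply: (mod27 16 25) | apply: (mod27 25 7)];
    first [by rewrite geosum_iter | by []].
- have [s ->] := red _ _ _ Sb; have [q ->] := red _ _ _ b4.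
  rewrite !modn_small //.
  have -> : 1 + (q * 9 + 4 - 2) * (s * 9 + 4)
    = 9 * (1 + q * 9 * s + 4 * q + 2 * s) by lia.
  by rewrite dvdn_mulr.
- have [s ->] := red _ _ _ Sal; have [q ->] := red _ _ _ a7.
  by apply: (gcd9 _ (3 * q * s + q + 2 * s) 2) => //; rewrite !modn_small //; lia.
have [s ->] := red _ _ _ Sbl; have [q ->] := red _ _ _ b4.
by apply: (gcd9 _ (3 * q * s + q + s) 1) => //; rewrite !modn_small //; lia.
Qed.

Local Open Scope group_scope.

Lemma pgroup3_exponents (gT : finGroupType) a b (x y : gT) :
    3.-group (<[x]> <*> <[y]>) ->
    a = 7 %[mod 9] -> b = 4 %[mod 9] -> b <= a ->
    comm_pow a x y -> comm_pow b y x ->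
  [/\ x ^+ 9 = 1, y ^+ 9 = 1 & [~ x, y] ^+ 3 = 1].
Proof.
move=> p3 a7 b4 le_ba xa yb; set c := [~ x, y]; set l := a - b.
set v := (1 + (b - 2) * geosum b b)%N.
have l3 : l = 3 %[mod 9] by rewrite /l; lia.
have l_3 : 3 %| l by rewrite /dvdn; lia.
have a1 : a = 1 %[mod 3] by lia.
have b1 : b = 1 %[mod 3] by lia.
have b_gt1 : 1 < b by lia.
have a_gt1 : 1 < a by lia.
have [u27 v9 gx gy] := geosum_gcdn27 a7 b4 l3; rewrite -/v in v9.
have dE : [~ y, x] = c^-1 by rewrite invg_comm.
have nXc N : c \in 'N(<[x ^+ N]>) by apply: comm_normal xa.
have cXN N i (g : gT) : N %| i -> g ^+ i \in <[g ^+ N]>.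
  by move=> /dvdnP[j ->]; rewrite mulnC expgM mem_cycle.
have [z Zz F1] : exists2 z, z \in <[x ^+ 27]> & y ^+ v = c ^+ l * z.
  have yc i : (y ^+ (b * i)) ^ c = y ^+ i.
    by rewrite expgM -yb dE -conjXg conjgKV.
  (* Conjugation by [c] sends [x] to [x ^+ a] and [y ^+ b] to [y]. *)
  have E : [~ x, y ^+ b] ^ c = [~ x ^+ a, y].
    by rewrite conjRg xa -(muln1 b) yc.
  have cc i : (c^-1 ^+ i) ^ c = c^-1 ^+ i by rewrite conjXg conjVg conjgE mulKg.
  (* The sides expand to [(c^-1 ^+ b * y ^+ geosum b b)^-1 * y] and
     [x ^- a * c ^+ a * x ^+ (a * geosum a a)]; by [yE] and [xE] these are [y ^+ v * c ^+ b] and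
     [c ^+ a * x ^- u]. *)
  move: E; rewrite (commgEl (x ^+ a)) (conjX_comm_pow _ xa) (commgEr x) conjVg.
  rewrite -/c (conjX_comm_pow _ yb) dE conjMg conjVg conjMg cc yc.
  have -> : (y ^+ b) ^ c = y by rewrite -(muln1 b) yc.
  have bb : (b ^ b = geosum b b + v)%N.
    by rewrite expn_geosum2.
  set u := (a * _)%N in u27.
  have aa : (a * a ^ a = a * geosum a a + u)%N.
    by rewrite expn_geosum2 // mulnDr.
  have yE : y = c^-1 ^+ b * y ^+ geosum b b * y ^+ v * (c^-1 ^+ b)^-1.
    apply: (mulIg (c^-1 ^+ b)); rewrite mulgKV -mulgA -expgD -bb conjgC.
    by rewrite -dE -{2}(expg1 y) (comm_powX _ _ yb) mul1n.
  have xE : x ^+ a * c ^+ a * x ^- u = c ^+ a * x ^+ (a * geosum a a).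
    by rewrite (conjgC (x ^+ a)) (comm_powX _ _ xa) aa expgD mulgA mulgK.
  have -> : (c^-1 ^+ b * y ^+ geosum b b)^-1 * y = y ^+ v * (c^-1 ^+ b)^-1.
    by apply: (mulgI (c^-1 ^+ b * y ^+ geosum b b)); rewrite mulKVg [LHS]yE !mulgA.
  rewrite -xE -mulgA mulKg expVgn invgK => E; exists ((x ^- u) ^ (c ^- b)).
    rewrite memJ_norm; first by rewrite groupV; apply: cXN.
    by rewrite groupV groupX ?nXc.
  apply: (mulIg (c ^+ b)); rewrite E -mulgA conjgE invgK !mulgA mulgKV -expgD.
  by rewrite subnK.
have zx : z ^ x = z.
  by case/cycleP: Zz => i ->; rewrite -expgM conjXg conjgE mulKg.
pose D := (<[x ^+ 9]> <*> <[c ^+ 3]> <*> <[y ^+ 9]>)%G.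
have XCD := joing_subl (<[x ^+ 9]> <*> <[c ^+ 3]>) <[y ^+ 9]>.
have Dx : x ^+ 9 \in D.
  by rewrite (subsetP XCD) // (subsetP (joing_subl _ _)) ?cycle_id.
have Dc : c ^+ 3 \in D.
  by rewrite (subsetP XCD) // (subsetP (joing_subr _ _)) ?cycle_id.
have Dy : y ^+ 9 \in D by rewrite (subsetP (joing_subr _ _)) ?cycle_id.
have pD : 3.-group D.
  apply: pgroupS p3; rewrite !join_subG !cycle_subG.
  have [Gx Gy] : x \in <[x]> <*> <[y]> /\ y \in <[x]> <*> <[y]>.
    by rewrite -!cycle_subG joing_subl joing_subr.
  by rewrite !groupX ?groupR.
(* The Frattini subgroup of a 3-group contains all cubes and is proper unless the group is trivial.
   The order matters: [y ^+ 9] comes first, as the other two memberships use it. *)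
set F := 'Phi(D)%G.
have FD g : g \in D -> g ^+ 3 \in F.
  move=> Dg; rewrite /= (Phi_joing pD) (subsetP (joing_subr _ _)) //.
  by rewrite (Mho_p_elt 1) ?(mem_p_elt pD).
have nFD : D \subset 'N(F) by rewrite normal_norm ?Phi_normal.
have Fm k i g : g ^+ k \in D -> (3 * k %| i)%N -> g ^+ i \in F.
  by move=> Dg /dvdnP[j ->]; rewrite mulnC (mulnC 3) !expgM groupX ?FD.
have Fx27 i : 27 %| i -> x ^+ i \in F by apply: (Fm 9).
have Fz : z \in F by case/cycleP: Zz => i ->; rewrite -expgM Fx27 ?dvdn_mulr.
have Fc9 i : 9 %| i -> c ^+ i \in F by apply: (Fm 3).
have Dcl : c ^+ l \in D.
  case/dvdnP: l_3 => i ->.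
  by rewrite mulnC expgM groupX.
(* Conjugating [F1] by [y] fixes the left side and puts [y ^+ ((b - 1) * geosum b l)] in front of
   [c ^+ l], so this power lies in [F]; its exponent has gcd 9 with 27. *)
have Fy9 : y ^+ 9 \in F.
  rewrite -gy; apply: groupX_gcd; last by apply: (Fm 9).
  have clE : (c ^+ l) ^ y = y ^+ ((b - 1) * geosum b l) * c ^+ l.
    apply: invg_inj; rewrite -conjVg -expVgn -dE (commX_conj _ yb).
    have -> : (b ^ l = ((b - 1) * geosum b l).+1)%N.
      by case: (b) b4 => // b' _; rewrite expn_geosum subn1.
    by rewrite expgS invMg -mulgA mulgKV dE expVgn invMg.
  have [w Fw zy] : exists2 w, w \in F & z ^ y = w.
    case/cycleP: Zz => i ->; rewrite -expgM (conjX_comm_pow _ xa).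
    exists (c ^+ (27 * i) * x ^+ (a * geosum a (27 * i))) => //.
    apply: groupM; first by apply: Fc9; apply: dvdn_mulr.
    apply: Fx27; apply: dvdn_mull; apply: (@dvdn_geosum 3 3) => //.
    by apply: dvdn_mulr.
  have := congr1 (conjg^~ y) F1.
  rewrite conjXg conjgE mulKg conjMg clE zy F1 => E.
  have FJ g : g \in F -> c ^+ l * g * c ^- l \in F.
    move=> Fg; rewrite -{1}(invgK (c ^+ l)) -mulgA -conjgE.
    by rewrite memJ_norm // groupV (subsetP nFD).
  by rewrite -(groupMr _ (FJ w Fw)) !mulgA -E FJ.
have Fc3 : c ^+ 3 \in F.
  have -> : 3 = gcdn l 9 by rewrite -gcdn_modl l3.
  apply: groupX_gcd; last by rewrite Fc9.
  rewrite -(groupMr _ Fz) -F1; case/dvdnP: v9 => i ->.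
  by rewrite mulnC expgM groupX.
(* Conjugating [F1] by [x] fixes [z]; the left side becomes [c ^- v * y ^+ (b * geosum b v)], in [F]
   because 9 divides [v]. *)
have Fx9 : x ^+ 9 \in F.
  rewrite -gx; apply: groupX_gcd; last by apply: (Fm 9).
  have clE : (c ^+ l) ^ x = c ^+ l * x ^- ((a - 1) * geosum a l).
    rewrite (commX_conj _ xa).
    have -> : (a ^ l = ((a - 1) * geosum a l).+1)%N.
      by case: (a) a7 => // a' _; rewrite expn_geosum subn1.
    by rewrite expgS invMg -!mulgA mulVg mulg1.
  have := congr1 (conjg^~ x) F1.
  rewrite (conjX_comm_pow _ yb) conjMg clE zx => E.
  have Fcl : c ^+ l \in F.
    by rewrite -(groupMr _ Fz) -F1; case/dvdnP: v9 => i ->; rewrite mulnC expgM groupX.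
  rewrite -groupV -(groupMr _ Fz) -(groupMl _ Fcl) mulgA -E dE expVgn.
  rewrite groupM ?groupV ?Fc9 //.
  have /dvdnP[i ->] : 9 %| b * geosum b v; last by rewrite mulnC expgM groupX.
  by rewrite dvdn_mull //; apply: (@dvdn_geosum 3 2).
have D1 : D :=: 1.
  apply: contraTeq (subxx D) => ntD.
  have := Phi_proper ntD; rewrite properE => /andP[_]; apply: contra => _.
  by rewrite !join_subG !cycle_subG Fx9 Fc3.
move: Dx Dc Dy; rewrite !D1 => /set1P-> /set1P-> /set1P->.
by [].
Qed.

(** This is [triple_product] with [N = 1]; taking [p = 1] makes the congruences trivial. *)
Lemma joing_triple (gT : finGroupType) a b (x y : gT) :
    0 < a -> 0 < b -> comm_pow a x y -> comm_pow b y x ->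
  <[x]> <*> <[y]> = <[x]> * <[[~ x, y]]> * <[y]>.
Proof.
move=> a0 b0 xa yb.
have mod1 n : n = 1 %[mod 1] by rewrite !modn1.
have [K dK _] := @triple_product _ 1 0 a b x y a0 b0 xa yb (mod1 a) (mod1 b).
rewrite !expg1 in dK; rewrite -dK; apply/eqP; rewrite eqEsubset; apply/andP; split.
  have m1 (A B : {group gT}) : 1 \in A * B by rewrite -(mulg1 1) mem_mulg.
  by rewrite join_subG dK mulg_subr ?m1 // -mulgA mulg_subl ?m1.
have [Gx Gy] : x \in <[x]> <*> <[y]> /\ y \in <[x]> <*> <[y]>.
  by rewrite -!cycle_subG joing_subl joing_subr.
by rewrite dK !mul_subG ?cycle_subG ?groupR.
Qed.

(** * A permutation model of order 3^5 and class 3 *)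

Definition seq_fun (s : seq nat) (i : 'I_9) : 'I_9 := inZp (nth 0 s i).

(* In the group of order 3^5, [mul7], [rot9] and [ub] are the actions of c, x, y
   on the 9 cosets of <c, y> (represented by the powers of x), and [mul7], [ua],
   [rot9] those of c, x, y on the 9 cosets of <x, c>; thus [ub] maps i to
   7 + ... + 7^i and [ua] maps i to 4 + ... + 4^i, modulo 9. *)
Definition rot_seq := [:: 1; 2; 3; 4; 5; 6; 7; 8; 0]%N.
Definition mul7_seq := [:: 0; 7; 5; 3; 1; 8; 6; 4; 2]%N.
Definition ub_seq := [:: 0; 7; 2; 3; 1; 5; 6; 4; 8]%N.
Definition ua_seq := [:: 0; 4; 2; 3; 7; 5; 6; 1; 8]%N.

Ltac check_I9 :=
  by move=> [[|[|[|[|[|[|[|[|[|i]]]]]]]]] //= Hi]; apply: val_inj.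

(** The inverses are iterates: the rotation has order 9, the other three maps order 3. *)
Lemma rot_inj : injective (seq_fun rot_seq).
Proof. by apply: (can_inj (g := iter 8 (seq_fun rot_seq))); check_I9. Qed.
Lemma mul7_inj : injective (seq_fun mul7_seq).
Proof. by apply: (can_inj (g := iter 2 (seq_fun mul7_seq))); check_I9. Qed.
Lemma ub_inj : injective (seq_fun ub_seq).
Proof. by apply: (can_inj (g := iter 2 (seq_fun ub_seq))); check_I9. Qed.
Lemma ua_inj : injective (seq_fun ua_seq).
Proof. by apply: (can_inj (g := iter 2 (seq_fun ua_seq))); check_I9. Qed.

Definition rot9 := perm rot_inj.
Definition mul7 := perm mul7_inj.
Definition ub := perm ub_inj.
Definition ua := perm ua_inj.

Ltac check_perm :=
  apply/permP; rewrite ?expgS ?expg0; let i := fresh "i" in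
  intro i; rewrite !(permM, perm1, permE); revert i; check_I9.

Lemma rotX i : val ((rot9 ^+ i) ord0) = i %% 9 :> nat.
Proof.
elim: i => [|i IHi]; first by rewrite expg0 perm1.
have step (j : 'I_9) : val (seq_fun rot_seq j) = (val j).+1 %% 9 :> nat.
  by case: j => [[|[|[|[|[|[|[|[|[|j]]]]]]]]] //= Hj].
by rewrite expgSr permM permE step IHi -(addn1 (i %% 9)) modnDml addn1.
Qed.

(** Neither action is faithful: [y ^+ 3] acts trivially in the first and [x ^+ 3] in the second. *)
Definition modelT : finGroupType := ({perm 'I_9} * {perm 'I_9})%type.

Definition mA : modelT := (rot9, ua).
Definition mB : modelT := (ub, rot9).
Definition mC : modelT := (mul7, mul7).

Lemma modelT_eq (u v : modelT) : u.1 = v.1 -> u.2 = v.2 -> u = v.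
Proof. by case: u v => [u1 u2] [v1 v2] /= -> ->. Qed.

Lemma mC_comm : [~ mA, mB] = mC.
Proof.
have E : mB * mA * mC = mA * mB by apply: modelT_eq => /=; check_perm.
by rewrite commgEl conjgE mulgA -invMg -E mulKg.
Qed.

Lemma mA_pow : comm_pow 7 mA mB.
Proof.
rewrite /comm_pow mC_comm.
have E : mA * mC = mC * mA ^+ 7 by apply: modelT_eq => /=; check_perm.
by rewrite conjgE E mulKg.
Qed.

Lemma mB_pow : comm_pow 4 mB mA.
Proof.
rewrite /comm_pow -invg_comm mC_comm.
have E : mC * mB = mB ^+ 4 * mC by apply: modelT_eq => /=; check_perm.
by rewrite conjgE invgK mulgA E mulgK.
Qed.

(** The point 0 separates the factors: in the first coordinate [mC] fixes it while [mA] rotates; in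
    the second [mA] and [mC] fix it while [mB] rotates. *)
Lemma model_card_orders :
  [/\ #|<[mA]> * <[mC]> * <[mB]>| = 243, #[mA] = 9, #[mB] = 9
     & (<[mA]> * <[mC]>) :&: <[mB]> = 1].
Proof.
have rot_fix i : (rot9 ^+ i) ord0 = ord0 -> 9 %| i.
  by move/(congr1 val); rewrite rotX => /eqP.
have fst_X (u : modelT) i : (u ^+ i).1 = u.1 ^+ i.
  by elim: i => // i IHi; rewrite !expgS -IHi.
have snd_X (u : modelT) i : (u ^+ i).2 = u.2 ^+ i.
  by elim: i => // i IHi; rewrite !expgS -IHi.
have A9 : mA ^+ 9 = 1 by apply: modelT_eq => /=; check_perm.
have B9 : mB ^+ 9 = 1 by apply: modelT_eq => /=; check_perm.
have C3 : mC ^+ 3 = 1 by apply: modelT_eq => /=; check_perm.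
have fix0X (s : {perm 'I_9}) i : s ord0 = ord0 -> (s ^+ i) ord0 = ord0.
  by move=> s0; elim: i => [|i IHi]; rewrite ?expg0 ?perm1 // expgS permM s0.
have mul7_0 : mul7 ord0 = ord0 by rewrite permE; apply: val_inj.
have ua_0 : ua ord0 = ord0 by rewrite permE; apply: val_inj.
have order9 u : u ^+ 9 = 1 -> (forall i, u ^+ i = 1 -> 9 %| i) -> #[u] = 9.
  move=> u9 Du; apply/eqP; rewrite eqn_dvd order_dvdn u9 eqxx.
  exact: Du (expg_order u).
have oA : #[mA] = 9.
  apply: order9 => // i /(congr1 fst).
  by rewrite fst_X => /permP/(_ ord0); rewrite perm1 => /rot_fix.
have oB : #[mB] = 9.
  apply: order9 => // i /(congr1 snd).
  by rewrite snd_X => /permP/(_ ord0); rewrite perm1 => /rot_fix.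
have oC : #[mC] = 3.
  apply: nt_prime_order => //; apply/eqP => /(congr1 fst)/permP/(_ (inZp 1)).
  by rewrite perm1 permE => /(congr1 val).
have AC_TI : <[mA]> :&: <[mC]> = 1.
  apply/trivgP/subsetP=> _ /setIP[/cycleP[i ->] /cycleP[j /(congr1 fst)]].
  rewrite !fst_X => /permP/(_ ord0); rewrite /= (fix0X mul7) // => /rot_fix/dvdnP[k ->].
  by rewrite mulnC expgM A9 expg1n inE.
have dAC : <[mA]> <*> <[mC]> = <[mA]> * <[mC]>.
  by rewrite norm_joinEr // cycle_subG -mC_comm -(expg1 mA) (comm_normal 1 mA_pow).
have ACB_TI : (<[mA]> * <[mC]>) :&: <[mB]> = 1.
  rewrite -dAC; apply/trivgP; rewrite /= dAC.
  apply/subsetP=> g /setIP[/mulsgP[_ _ /cycleP[i ->] /cycleP[j ->] ->] /cycleP[k def_g]].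
  have := congr1 snd def_g; rewrite /= !snd_X => /permP/(_ ord0).
  rewrite permM (fix0X ua) // (fix0X mul7) // => /esym/rot_fix/dvdnP[k' def_k].
  by rewrite def_g def_k mulnC expgM B9 expg1n inE.
split=> //; have := @TI_cardMg _ (<[mA]> <*> <[mC]>)%G <[mB]>%G.
rewrite /= dAC => /(_ ACB_TI) ->; rewrite (@TI_cardMg _ <[mA]>%G <[mC]>%G) //.
by rewrite -!orderE oA oB oC.
Qed.

(** The class exceeds 2 since [mC] and [mA] do not commute. The cubes of [mA] and [mB] give a centre
    of order at least 9, so the central quotient has order at most 27 and class at most 2. *)
Lemma model_group :
  {H : {group modelT} | <[mA]> <*> <[mB]> = H & #|H| = 243 /\ nil_class H = 3}.
Proof.
have [cardH oA oB TI] := model_card_orders.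
exists (<[mA]> <*> <[mB]>)%G => //; set H := (_ <*> _)%G.
have oH : #|H| = 243 by rewrite /= (joing_triple _ _ mA_pow mB_pow) // mC_comm.
have HA : mA \in H by rewrite (subsetP (joing_subl _ _)) ?cycle_id.
have HB : mB \in H by rewrite (subsetP (joing_subr _ _)) ?cycle_id.
have pH : 3.-group H by rewrite /pgroup oH.
have nilH := pgroup_nil pH.
split=> //; apply/eqP; rewrite eqn_leq; apply/andP; split; last first.
  rewrite ltnNge; apply/negP => /(lcn_nil_classP _ nilH) L3.
  have : [~ [~ mA, mB], mA] \in 'L_3(H) by rewrite !lcnSn !mem_commg.
  rewrite L3 mC_comm => /set1P/eqP/commgP/(congr1 fst)/permP/(_ ord0).
  by rewrite !permM !permE => /(congr1 val).
have ZA : mA ^+ 3 \in 'Z(H).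
  rewrite inE groupX //= centY inE !cent_cycle.
  apply/andP; split; apply/cent1P; first exact/commute_sym/commuteX.
  by apply: modelT_eq => /=; check_perm.
have ZB : mB ^+ 3 \in 'Z(H).
  rewrite inE groupX //= centY inE !cent_cycle.
  apply/andP; split; apply/cent1P; last exact/commute_sym/commuteX.
  by apply: modelT_eq => /=; check_perm.
have oZ : 9 <= #|'Z(H)|.
  have TI3 : <[mA ^+ 3]> :&: <[mB ^+ 3]> = 1.
    apply/trivgP; rewrite -TI setISS ?cycleX //.
    by rewrite (subset_trans (cycleX _ _)) ?mulG_subl.
  have <- : #|<[mA ^+ 3]> * <[mB ^+ 3]>| = 9.
    by rewrite TI_cardMg // -!orderE !orderXdiv ?oA ?oB.
  by rewrite subset_leq_card // mul_subG ?cycle_subG.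
have cH : nil_class (H / 'Z(H)) = (nil_class H).-1 by apply: nil_class_quotient_center.
have := nil_class_pgroup (quotient_pgroup 'Z(H) pH).
have : #|H / 'Z(H)| <= 27.
  rewrite card_quotient ?normal_norm ?center_normal // -divgS ?center_sub //.
  rewrite leq_divLR ?cardSg ?center_sub // oH.
  by apply: leq_trans (leq_mul (leqnn 27) oZ).
rewrite cH => le27.
have : logn 3 #|H / 'Z(H)| <= 3.
  rewrite -(@leq_exp2l 3) //; apply: leq_trans le27.
  by rewrite dvdn_leq ?pfactor_dvdnn.
by rewrite /H; case: (nil_class _) => [|[|[|[|n]]]] //=;
  case: (logn _ _) => [|[|[|[|m]]]].
Qed.

(** * Passage between the group, its 3-quotient and the model *)

Lemma int_exponent (alpha : int) (r N m : nat) :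
    (alpha = r %[mod 9])%Z -> (0 < N)%N ->
  exists k, [/\ k = r %[mod 9], (m <= k)%N & forall (gT : finGroupType) (g : gT),
    g ^+ (9 * N) = 1 -> g ^+ zpos alpha * g ^- zneg alpha = g ^+ k].
Proof.
(* A large multiple of [9 * N] added to [alpha] keeps the residue modulo 9 and yields a natural
   exponent of size at least [m]. *)
case: alpha => n /= alphar N_gt0.
  exists (9 * N * m + n)%N; split; [by lia | by nia | move=> gT g gN].
  by rewrite invg1 mulg1 expgD expgM gN expg1n mul1g.
have le_n : (n.+1 <= 9 * N * (m + n.+1))%N by nia.
exists (9 * N * (m + n.+1) - n.+1)%N; split; [by lia | by nia | move=> gT g gN].
apply: (mulIg (g ^+ n.+1)).
by rewrite mul1g mulVg -expgD subnK // expgM gN expg1n.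
Qed.

Lemma card_mulG_dvd (gT : finGroupType) (G H : {group gT}) :
  #|G * H| %| #|G| * #|H|.
Proof. by rewrite mul_cardG dvdn_mulr. Qed.

(** The order of [u] divides [m * #|K|], whose [p]-part is [m]. This carries orders in the quotient
    back to the [p]-constituents of elements. *)
Lemma order_part_coset (gT : finGroupType) (p : nat) (K : {group gT}) u :
  p^'.-group K -> u \in 'N(K) -> p.-nat #[coset K u] -> (#[u]`_p)%N = #[coset K u].
Proof.
move=> p'K nKu; set m := #[_] => pm; apply/eqP; rewrite eqn_dvd -{2}(part_pnat_id pm).
rewrite [X in _ && X]partn_dvd ?order_gt0 ?morph_order // andbT.
have Kum : u ^+ m \in K by rewrite coset_idr ?groupX // morphX // expg_order.
have : #[u] %| m * #|K| by rewrite order_dvdn expgM -order_dvdn order_dvdG.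
move/(partn_dvd p); rewrite muln_gt0 order_gt0 cardG_gt0 => /(_ isT).
by rewrite partnM ?order_gt0 ?cardG_gt0 // (part_pnat_id pm) (part_p'nat p'K) muln1.
Qed.

Lemma comm_pow_coset (gT : finGroupType) (K : {group gT}) a x y :
  x \in 'N(K) -> y \in 'N(K) -> comm_pow a x y -> comm_pow a (coset K x) (coset K y).
Proof.
move=> nKx nKy xa.
by rewrite /comm_pow -morphR //= -morphJ ?groupR //= xa morphX.
Qed.

Lemma quotient_gen2 (gT : finGroupType) (K : {group gT}) x y :
    x \in 'N(K) -> y \in 'N(K) ->
  (<[x]> <*> <[y]>) / K = <[coset K x]> <*> <[coset K y]>.
Proof. by move=> nKx nKy; rewrite quotientY ?cycle_subG // !quotient_cycle. Qed.

Lemma sub_mulG3 (gT : finGroupType) (A B C : {group gT}) :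
  [/\ A \subset A * B * C, B \subset A * B * C & C \subset A * B * C].
Proof.
have sAB := mulG_subl B A; have sBA := mulG_subr A B.
have sABC : A * B \subset A * B * C by rewrite mulg_subl.
split; [exact: subset_trans sABC | exact: subset_trans sABC |].
by rewrite mulg_subr // -(mulg1 1) mem_mulg.
Qed.

Lemma pgroup_mulG3 (gT : finGroupType) (pi : nat_pred) (A B C : {group gT}) :
    B \subset 'N(A) ->
  pi.-group (A * B * C) = [&& pi.-group A, pi.-group B & pi.-group C].
Proof.
by move=> nAB; rewrite -norm_joinEr // pgroupM /= norm_joinEr // pgroupM andbA.
Qed.

Lemma card_mulG3_dvd (gT : finGroupType) (A B C : {group gT}) :
  B \subset 'N(A) -> #|A * B * C| %| #|A| * #|B| * #|C|.
Proof.
move=> nAB; rewrite -norm_joinEr //; apply: dvdn_trans (card_mulG_dvd _ _) _.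
by rewrite dvdn_pmul2r ?cardG_gt0 //= norm_joinEr // card_mulG_dvd.
Qed.

(** For [N] the 3-part of the group order, [N]-th powers have order prime to 3, and modulo [K] the
    three cyclic factors have order dividing [N]. *)
Lemma normal_complement3 (gT : finGroupType) (G : {group gT}) a b x y :
    <[x]> <*> <[y]> = G ->
    (0 < a)%N -> (0 < b)%N -> a = 1 %[mod 3] -> b = 1 %[mod 3] ->
    comm_pow a x y -> comm_pow b y x ->
  {K : {group gT} | K <| G /\ 3^'.-group K & 3.-group (G / K)}.
Proof.
move=> genG a0 b0 a1 b1 xa yb; set N := (#|G|`_3)%N.
have [K] := @triple_product _ 3 (logn 3 #|G|) a b x y a0 b0 xa yb a1 b1.
rewrite -p_part -/N => dK /andP[nKx nKy].
have [Gx Gy] : x \in G /\ y \in G.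
  by rewrite -genG -!cycle_subG joing_subl joing_subr.
have Gc : [~ x, y] \in G by rewrite groupR.
have nKG : G \subset 'N(K) by rewrite -genG join_subG !cycle_subG nKx.
have sKG : K \subset G by rewrite dK !mul_subG ?cycle_subG ?groupX.
have p'N g : g \in G -> 3^'.-group <[g ^+ N]>.
  move=> Gg; apply: (@pnat_dvd _ (#|G|`_3^')%N); last exact: part_pnat.
  by rewrite -orderE order_dvdn -expgM partnC ?cardG_gt0 // expg_cardG.
have p'K : 3^'.-group K.
  rewrite dK pgroup_mulG3 ?p'N //.
  by rewrite cycle_subG groupX // (comm_normal N xa).
exists K; first by rewrite /normal sKG.
have [nKx' nKy'] := (nKx, nKy).
have Q g : g \in G -> g ^+ N \in K -> 3.-group <[coset K g]>.
  move=> Gg KgN; apply: (@pnat_dvd _ N); last exact: part_pnat.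
  by rewrite -orderE order_dvdn -morphX ?(subsetP nKG) //= coset_id.
have [xa' yb'] : comm_pow a (coset K x) (coset K y) /\ comm_pow b (coset K y) (coset K x).
  by split; apply: comm_pow_coset.
rewrite -genG quotient_gen2 // (joing_triple a0 b0 xa' yb') -morphR //=.
have := comm_normal 1 xa'; rewrite expg1 -morphR //= => nXc.
rewrite pgroup_mulG3 ?cycle_subG //.
have [sX sZ sY] := sub_mulG3 <[x ^+ N]> <[[~ x, y] ^+ N]> <[y ^+ N]>.
rewrite -!dK in sX sZ sY.
by rewrite !Q ?(subsetP sX _ (cycle_id _)) //
  ?(subsetP sZ _ (cycle_id _)) ?(subsetP sY _ (cycle_id _)).
Qed.

Lemma max_mul3_eq (o1 o2 o3 : nat) :
  (o1 <= 9 -> o2 <= 3 -> o3 <= 9 -> 243 <= o1 * o2 * o3 ->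
  [/\ o1 = 9, o2 = 3 & o3 = 9])%N.
Proof.
move=> o1_9 o2_3 o3_9 le243.
have := leq_mul (leq_mul (leqnn o1) o2_3) o3_9.
have := leq_mul (leq_mul o1_9 (leqnn o2)) o3_9.
have := leq_mul (leq_mul o1_9 o2_3) (leqnn o3).
by split; lia.
Qed.

Lemma homGrp_macdonald (rT : finGroupType) (u v : rT) (m1 n1 m2 n2 : nat) :
    u ^ [~ u, v] = u ^+ m1 * u ^- n1 -> v ^ [~ v, u] = v ^+ m2 * v ^- n2 ->
  <[u]> <*> <[v]> \homg Grp (A : B :
    A ^ [~ A, B] = A ^+ m1 * A ^- n1, B ^ [~ B, A] = B ^+ m2 * B ^- n2).
Proof.
by move=> uE vE; apply/existsP; exists (u, v); rewrite /= !xpair_eqE !eqxx uE vE !eqxx.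
Qed.

Unset Implicit Arguments.

Theorem theorem10p1 (alpha beta : int) :
  (alpha = 7 %[mod 9])%Z -> (beta = 4 %[mod 9])%Z ->
  forall (gT : finGroupType) (G : {group gT}) (x y : gT),
    G \isog Grp (A : B :
        A ^ [~ A, B] = A ^+ zpos alpha * A ^- zneg alpha,
        B ^ [~ B, A] = B ^+ zpos beta * B ^- zneg beta) ->
    <[x]> <*> <[y]> = G ->
    x ^ [~ x, y] = x ^+ zpos alpha * x ^- zneg alpha ->
    y ^ [~ y, x] = y ^+ zpos beta * y ^- zneg beta ->
    forall P : {group gT}, P \in 'Syl_3(G) ->
      [/\ #|P| = (3 ^ 5)%N, nil_class P = 3%N,
          #[x.`_3] = 9%N, #[y.`_3] = 9%N & #[([~ x, y]).`_3] = 3%N].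
Proof.
move=> alpha7 beta4 gT G x y isoG genG xalpha ybeta P.
rewrite inE => sylP.
(* The natural exponents are valid in [G] and in the model, both killed on generators by [9 * #|G|];
   choosing [a] after [b] ensures [b <= a]. *)
have [b [b4 b0 bE]] := @int_exponent beta 4 #|G| 1 beta4 (cardG_gt0 G).
have [a [a7 le_ba aE]] := @int_exponent alpha 7 #|G| b alpha7 (cardG_gt0 G).
have a0 := leq_trans b0 le_ba.
have a1 : a = 1 %[mod 3] by rewrite -(@modn_dvdm 9 a 3) // a7.
have b1 : b = 1 %[mod 3] by rewrite -(@modn_dvdm 9 b 3) // b4.
have [Gx Gy] : x \in G /\ y \in G.
  by rewrite -genG -!cycle_subG joing_subl joing_subr.
have expG g : g \in G -> g ^+ (9 * #|G|) = 1.
  by move=> Gg; rewrite mulnC expgM expg_cardG ?expg1n.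
have xa : comm_pow a x y by rewrite /comm_pow xalpha aE ?expG.
have yb : comm_pow b y x by rewrite /comm_pow ybeta bE ?expG.
have [H dH [oH cH]] := model_group.
(* By the universal property of the presentation, [G] maps onto the model. *)
have [f dfG] : exists f : {morphism G >-> modelT}, f @* G = H.
  have [_ oA oB _] := model_card_orders.
  have A9 : mA ^+ 9 = 1 by rewrite -oA expg_order.
  have B9 : mB ^+ 9 = 1 by rewrite -oB expg_order.
  apply/homgP; rewrite isoG -dH; apply: homGrp_macdonald.
    by rewrite aE ?(expgM _ 9) ?A9 ?expg1n // -(expg_mod a A9) a7 mA_pow.
  by rewrite bE ?(expgM _ 9) ?B9 ?expg1n // -(expg_mod b B9) b4 mB_pow.
have [K [/andP[sKG nKG] p'K] pQ] := normal_complement3 genG a0 b0 a1 b1 xa yb.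
have [nKx nKy] := (subsetP nKG x Gx, subsetP nKG y Gy).
have nKc : [~ x, y] \in 'N(K) by rewrite groupR.
have xa' := comm_pow_coset nKx nKy xa; have yb' := comm_pow_coset nKy nKx yb.
have genQ : G / K = <[coset K x]> <*> <[coset K y]> by rewrite -genG quotient_gen2.
have pQ' : 3.-group (<[coset K x]> <*> <[coset K y]>) by rewrite -genQ.
have [x9 y9 c3] := pgroup3_exponents pQ' a7 b4 le_ba xa' yb'.
have cardG : #|G| = (#|K| * #|G / K|)%N by rewrite card_quotient // Lagrange.
have dvdQ : 243 %| #|G / K|.
  have : 243 %| #|G| by rewrite -oH -dfG dvdn_morphim.
  rewrite cardG Gauss_dvdr // (@coprime_pexpl 5 3) // prime_coprime //.
  by rewrite -p'natE.
have leQ : #|G / K| %| #[coset K x] * #[coset K [~ x, y]] * #[coset K y].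
  rewrite genQ (joing_triple a0 b0 xa' yb') -morphR //=.
  have := comm_normal 1 xa'; rewrite expg1 -morphR //= => nXc.
  by rewrite !orderE card_mulG3_dvd ?cycle_subG.
have [ox oy oc] : [/\ #[coset K x] %| 9, #[coset K y] %| 9 & #[coset K [~ x, y]] %| 3].
  by rewrite !order_dvdn x9 y9 morphR //= c3.
(* The lower bound 243 from the model meets the upper bound 9 * 3 * 9, which forces all three
   orders. *)
have oxyc : [/\ #[coset K x] = 9, #[coset K [~ x, y]] = 3 & #[coset K y] = 9]%N.
  apply: max_mul3_eq; try exact: dvdn_leq.
  by rewrite dvdn_leq ?muln_gt0 ?order_gt0 // (dvdn_trans dvdQ).
have [ox9 oc3 oy9] := oxyc.
have oQ : #|G / K| = 243.
  by apply/eqP; rewrite eqn_dvd dvdQ andbT; move: leQ; rewrite ox9 oc3 oy9.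
have oP : #|P| = 243.
  rewrite (card_Hall sylP) cardG oQ partnM ?cardG_gt0 // (part_p'nat p'K) mul1n.
  by rewrite part_pnat_id.
split=> //.
- rewrite -cH; apply/esym/isog_nil_class.
  (* The image of [P] is a Sylow 3-subgroup of the 3-group [H], hence all of it; equal orders make
     [P] isomorphic to [H]. *)
  have fP : f @* P = H.
    have := morphim_pHall f (pHall_sub sylP) sylP; rewrite dfG => sylH.
    by apply/eqP; rewrite eqEcard (pHall_sub sylH) (card_Hall sylH) oH part_pnat_id.
  have homHP : H \homg P by rewrite -fP morphim_homg ?(pHall_sub sylP).
  by rewrite isogEcard homHP oP oH.
- by rewrite order_constt (order_part_coset p'K) ?ox9.
- by rewrite order_constt (order_part_coset p'K) ?oy9.
by rewrite order_constt (order_part_coset p'K) ?oc3.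
Qed.
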